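(* Let $\Phi=(\Phi_X)_{X\subset\mathbb Z^d,\ X\text{ finite}}$ be a translation invariant, finite range interaction on $\Omega=\{1,-1\}^{\mathbb Z^d}$ with $\sum_{X\ni 0}\|\Phi_X\|<\infty$, and let $\mu$ be a Gibbs measure for $\Phi$. Let $G=\bigcup_{N\in\mathbb N}G_N$ be either the group of local spin exchanges or the group of local spin flips (defined in the context), acting on $\mathcal A=C(\Omega)$. Then $\mu$ is $G$-strongly quasi-invariant, with cocycles $x_\tau$ given by $$x_\tau(\omega)=\exp\left[H(\omega)-H(\tau^{-1}(\omega))\right],\qquad \tau\in G,\ \omega\in\Omega,$$ that is, $\mu(\tau(f))=\mu(x_\tau f)$ for all $f\in C(\Omega)$, $\tau\in G$, where the exponent is defined by $$H(\omega)-H(\tau^{-1}(\omega)):=\lim_{N\to\infty}\sum_{X\subset\Lambda_N}\left(\Phi_X(\omega)-\Phi_X(\tau^{-1}(\omega))\right),\qquad \Lambda_N=[-N,N]^d\cap\mathbb Z^d,$$ which is well defined since $\tau$ changes configurations only locally.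
   Context: Spin space: $\Omega_0=\{1,-1\}$ with $\mu_0(\{1\})=\mu_0(\{-1\})=\tfrac12$; for $\Lambda\subset\mathbb Z^d$, $\Omega_\Lambda=\Omega_0^\Lambda$ with product measure $\mu_\Lambda$; $\Omega=\Omega_{\mathbb Z^d}$ (a compact space); $\mathcal F_\Lambda$ is the $\sigma$-algebra on $\Omega$ generated by the spins in $\Lambda$, and $\mathcal F=\mathcal F_{\mathbb Z^d}$. An interaction is a family $(\Phi_X)$, indexed by finite $X\subset\mathbb Z^d$, of $\mathcal F_X$-measurable functions $\Phi_X:\Omega\to\mathbb R$; $\|\cdot\|$ is the sup norm. Translation invariance: $\Phi_X(\sigma_i(\omega))=\Phi_{X+i}(\omega)$, where $(\sigma_i(\omega))_j=\omega_{j+i}$. Finite range: there is $R>0$ with $\Phi_X=0$ if $\mathrm{diam}(X)>R$. For finite $\Lambda$: $H_\Lambda^\Phi(\zeta|\omega)=\sum_{X\cap\Lambda\ne\emptyset}\Phi_X(\zeta_\Lambda\omega_{\Lambda^c})$, where $\zeta_\Lambda\omega_{\Lambda^c}$ equals $\zeta$ on $\Lambda$ and $\omega$ on $\Lambda^c$; $Z_\Lambda^\Phi(\omega)=\int_{\Omega_\Lambda}\exp[-H_\Lambda^\Phi(\zeta|\omega)]\,d\mu_\Lambda(\zeta_\Lambda)$; and $$\gamma_\Lambda^\Phi(A|\omega)=\frac1{Z_\Lambda^\Phi(\omega)}\int_{\Omega_\Lambda}\exp[-H_\Lambda^\Phi(\zeta|\omega)]\,1_A(\zeta_\Lambda\omega_{\Lambda^c})\,d\mu_\Lambda(\zeta_\Lambda),\quad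 A\in\mathcal F.$$ A probability measure $\mu$ on $(\Omega,\mathcal F)$ is a Gibbs measure for $\Phi$ if $\mathbb E_\mu[1_A|\mathcal F_{\Lambda^c}]=\gamma_\Lambda^\Phi(A|\cdot)$ $\mu$-a.s. for all $A\in\mathcal F$ and all finite $\Lambda\subset\mathbb Z^d$. Write $\mu(f)=\int f\,d\mu$; $\mu$ is regarded as a state on $C(\Omega)$. Groups: a continuous bijection $\tau:\Omega\to\Omega$ induces an automorphism of $\mathcal A=C(\Omega)$, also denoted $\tau$, by $\tau(f)(\omega)=f(\tau(\omega))$. Spin exchanges: $G_N$ is generated by $\tau_{ij}$, $i\ne j\in\Lambda_N$, where $\tau_{ij}(\omega)$ is $\omega$ with the spins at $i$ and $j$ interchanged. Spin flips: $G_N$ is generated by $\tau_i$, $i\in\Lambda_N$, where $\tau_i(\omega)$ is $\omega$ with the spin at $i$ multiplied by $-1$. A (faithful) state $\varphi$ on a $C^*$-algebra $\mathcal A$ is $G$-strongly quasi-invariant if for every $\tau\in G$ there is a self-adjoint $x_\tau\in\mathcal A$ with $\varphi(\tau(a))=\varphi(x_\tau a)$ for all $a\in\mathcal A$. *)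

(* Defs.v *)
From HB Require Import structures.
From mathcomp Require Import all_boot all_order all_algebra finmap.
From mathcomp Require Import all_classical all_reals all_analysis.
From mathcomp Require Import complex.

Set Implicit Arguments.
Unset Strict Implicit.
Unset Printing Implicit Defensive.

Import Order.TTheory GRing.Theory Num.Theory.
Import numFieldNormedType.Exports.

Local Open Scope classical_set_scope.
Local Open Scope ring_scope.

(** * Configurations *)

Definition site (d : nat) := 'rV[int]_d.

(* [true] stands for the spin +1 and [false] for the spin -1, so that
   multiplication of a spin by -1 is [negb]. *)
Definition spin := bool.

Definition config (d : nat) := {ptws site d -> spin}.

HB.instance Definition _ d := Topological.on (config d).
HB.instance Definition _ d := Pointed.on (config d).

Definition spin_events d (V : set (site d)) : set_system (config d) :=
  [set A | exists2 i, V i & exists s, A = [set w | w i = s]].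

Definition sigma_spins d (V : set (site d)) : set_system (config d) :=
  <<s spin_events V >>.

(* The measurable structure of [config d] is [sigma_spins setT]. *)
HB.instance Definition _ d := Measurable.copy (config d)
  (g_sigma_algebraType (spin_events [set: site d])).

(* The cube [-N, N]^d, see [in_box]. *)
Definition box d (N : nat) : {fset site d} :=
  [fset \row_k (((f : {ffun 'I_d -> 'I_N.*2.+1}) k : nat)%:Z - N%:Z)
     | f in {ffun 'I_d -> 'I_N.*2.+1}]%fset.

Lemma in_box d N (x : site d) :
  (x \in box d N) = [forall k, - N%:Z <= x 0 k <= N%:Z].
Proof.
apply/imfsetP/forallP => [[f _ ->] k|xN].
  rewrite mxE lerBrDr addNr lez_nat leq0n /= lerBlDr -PoszD lez_nat addnn.
  by rewrite -ltnS.
have le0 k : 0 <= x 0 k + N%:Z by have /andP[+ _] := xN k; rewrite -lerBlDr sub0r.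
exists [ffun k : 'I_d => inord `|(x 0 k + N%:Z)%R|%N] => //.
apply/rowP => k; rewrite mxE ffunE inordK ?gez0_abs ?addrK //.
rewrite ltnS -lez_nat gez0_abs // -addnn PoszD lerD2r.
by have /andP[] := xN k.
Qed.

Section measurability.
Context (R : realType) (d : measure_display) (T : measurableType d).

Definition measurable_wrt (G : set_system T) (f : T -> R) :=
  forall B, measurable B -> G (f @^-1` B).

(* [g] is a version of the conditional expectation of [f] given the
   sub-sigma-algebra [G]. *)
Definition is_cond_expectation (mu : probability T R) (G : set_system T)
    (f g : T -> R) :=
  [/\ measurable_wrt G g,
      mu.-integrable setT (EFin \o g) &
      forall B, G B ->
        (\int[mu]_(w in B) (g w)%:E = \int[mu]_(w in B) (f w)%:E)%E].

End measurability.

(** * Interactions *)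

Record interaction (R : realType) (d : nat) := Interaction {
  potential :> {fset site d} -> config d -> R;
  potential_meas : forall X,
    measurable_wrt (sigma_spins [set` X]) (potential X) }.

Section interactions.
Context (R : realType) (d : nat).
Implicit Types (Phi : interaction R d) (X : {fset site d}) (w : config d).

Definition shift_config (i : site d) w : config d := fun j => w (j + i).

Definition translation_invariant Phi := forall X (i : site d) w,
  Phi X (shift_config i w) = Phi [fset (x + i)%R | x in X]%fset w.

Definition diam X : nat :=
  (\max_(x <- X) \max_(y <- X) \max_(k < d) `|(x 0 k - y 0 k)%R|)%N.

Definition finite_range Phi := exists2 r : R, 0 < r &
  forall X, r < (diam X)%:R -> forall w, Phi X w = 0.

Definition sup_norm (f : config d -> R) : \bar R :=
  ereal_sup [set `|f w|%:E | w in setT].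

Definition absolutely_summable Phi :=
  (\esum_(X in [set X : {fset site d} | (0%R : site d) \in X]) sup_norm (Phi X)
     < +oo)%E.

End interactions.

(** * Gibbs measures *)

Section gibbs.
Context (R : realType) (d : nat).
Implicit Types (Phi : interaction R d) (L X : {fset site d}) (w : config d).

Definition splice L (z : {ffun L -> spin}) w : config d :=
  fun i => if insub i is Some j then z j else w i.

Definition mu0 (s : spin) : R := 2^-1.

(* The integral of [F] against the product measure on {1,-1}^L of copies of
   [mu0]. *)
Definition spin_integral L (F : {ffun L -> spin} -> R) : R :=
  \sum_(z : {ffun L -> spin}) (\prod_i mu0 (z i)) * F z.

(* The index set is infinite: [\sum_(X \in A)] adds up the nonzero terms when
   there are finitely many of them, which [finite_range] ensures, and is 0
   otherwise. *)
Definition hamiltonian Phi L (z : {ffun L -> spin}) w : R :=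
  \sum_(X \in [set X | (X `&` L != fset0)%fset]) Phi X (splice z w).

Definition partition_function Phi L w : R :=
  spin_integral (fun z : {ffun L -> spin} => expR (- hamiltonian Phi z w)).

Definition gibbs_kernel Phi L (A : set (config d)) w : R :=
  (partition_function Phi L w)^-1 *
  spin_integral (fun z : {ffun L -> spin} =>
    expR (- hamiltonian Phi z w) * \1_A (splice z w)).

Definition gibbs_measure Phi (mu : probability (config d) R) :=
  forall A, measurable A -> forall L,
    exists2 g, is_cond_expectation mu (sigma_spins (~` [set` L])) \1_A g &
      {ae mu, forall w, g w = gibbs_kernel Phi L A w}.

End gibbs.

(** * Groups of local transformations *)

Section groups.
Context (d : nat).
Implicit Types (tau : config d -> config d) (w : config d).

Inductive generated_group (S : set (config d -> config d)) :
    set (config d -> config d) :=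
| gen_sub tau : S tau -> generated_group S tau
| gen_id : generated_group S id
| gen_comp tau tau' : generated_group S tau -> generated_group S tau' ->
    generated_group S (tau \o tau')
| gen_inv tau tau' : generated_group S tau ->
    cancel tau tau' -> cancel tau' tau -> generated_group S tau'.

Definition spin_exchange (i j : site d) w : config d :=
  fun k => if k == i then w j else if k == j then w i else w k.

Definition spin_flip (i : site d) w : config d :=
  fun k => if k == i then ~~ w k else w k.

Definition exchange_group : set (config d -> config d) :=
  \bigcup_N generated_group [set tau | exists i j,
    [/\ i \in box d N, j \in box d N, i != j & tau = spin_exchange i j]].

Definition flip_group : set (config d -> config d) :=
  \bigcup_N generated_group [set tau | exists2 i,
    i \in box d N & tau = spin_flip i].

Definition config_inv tau : config d -> config d := pinv setT tau.

Lemma config_invK tau : bijective tau ->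
  cancel tau (config_inv tau) /\ cancel (config_inv tau) tau.
Proof.
move=> [tau' tauK tau'K]; split => w.
  by rewrite /config_inv pinvKV ?inE// => x y _ _; apply: can_inj tauK x y.
by rewrite /config_inv pinvK// inE; exists (tau' w); rewrite ?tau'K.
Qed.

End groups.

(** * Strong quasi-invariance *)

Section quasi_invariance.
Context (R : realType) (d : nat).
Implicit Types (Phi : interaction R d) (tau : config d -> config d).
Implicit Types (w : config d) (f : config d -> R[i]).

(* Membership in the C*-algebra C(Omega) of complex continuous functions;
   the topology of R[i] is carried by the alias R[i]^o. *)
Definition in_C f := continuous (f : config d -> R[i]^o).

Definition self_adjoint f := forall w, (f w)^* = f w.

Definition strongly_quasi_invariant_with
    (phi : (config d -> R[i]) -> R[i]) (G : set (config d -> config d))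
    (x : (config d -> config d) -> config d -> R[i]) :=
  forall tau, G tau ->
    [/\ in_C (x tau), self_adjoint (x tau) &
        forall f, in_C f -> phi (f \o tau) = phi (x tau \* f)].

Definition state_of (mu : probability (config d) R) f : R[i] :=
  ((\int[mu]_w complex.Re (f w)) +i* (\int[mu]_w complex.Im (f w)))%C.

Definition energy_increment Phi tau w (N : nat) : R :=
  \sum_(X <- fpowerset (box d N)) (Phi X w - Phi X (config_inv tau w)).

Definition energy_difference Phi tau w : R :=
  limn (energy_increment Phi tau w).

Definition gibbs_cocycle Phi tau w : R[i] :=
  (expR (energy_difference Phi tau w))%:C%C.

End quasi_invariance.

(* Main.v *)
Require Import Defs.
From HB Require Import structures.
From mathcomp Require Import all_boot all_order all_algebra finmap.
From mathcomp Require Import fingroup perm.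
From mathcomp Require Import all_classical all_reals all_analysis.
From mathcomp Require Import complex.
From mathcomp Require Import measurable_realfun zify.

Set Implicit Arguments.
Unset Strict Implicit.
Unset Printing Implicit Defensive.

Import Order.TTheory GRing.Theory Num.Theory.
Import numFieldNormedType.Exports.

Local Open Scope classical_set_scope.
Local Open Scope ring_scope.

(** Every [tau] in [G] only rearranges the patterns of spins inside some box
    [L]: there is a permutation [sigma] of {1,-1}^L such that [tau] replaces
    the pattern [z] on [L] by [sigma z] and keeps everything else
    ([local_group_block_permutation]).  By finite range, only finitely many
    [X] meet [L] with a nonzero potential.  For the other [X] the terms of the
    energy increment cancel, so the increment is eventually constant, equal to
    a difference of two Hamiltonians on [L] with the same boundary condition
    ([energy_incrementE], [energy_differenceE]).

    The Gibbs property, integrated over all configurations, says that [mu] is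
    a mixture: pick [w] according to [mu], resample the pattern [z] on [L] with
    the Boltzmann weight p(z, w), proportional to exp (- H(z | w)).  This gives
      mu(f) = \int sum_z p(z, w) f(z w_{L^c}) dmu(w)
    for every measurable [f >= 0] ([dlr_integral]).  Applied to [f \o tau],
    it produces the sum of p(z, w) f(sigma(z) w_{L^c}); applied to [x_tau f],
    it produces the sum of p(z, w) x_tau(z w_{L^c}) f(z w_{L^c}).  Since
      p(z, w) x_tau(z w_{L^c}) = p(sigma^-1 z, w)
    ([boltzmann_weight_energy]), the change of summation variable
    z := sigma z identifies the two sums, with [w] fixed.

    The identity passes to real functions through positive and negative parts:
    [x_tau] is positive, so multiplication by it commutes with taking either
    part ([integral_block_permutation]).  Complex functions are handled through
    their real and imaginary parts.
    Continuity and measurability all come from one fact: a function of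
    finitely many spins is both, and cylinders over boxes form a countable
    family of neighborhoods that detects open sets. *)

(** * Functions of finitely many spins *)

Section local_functions.
Context (d : nat).
Implicit Types (w : config d) (V L : {fset site d}).

Definition depends_on (T : Type) V (f : config d -> T) :=
  forall w w', {in V, w =1 w'} -> f w = f w'.

Definition pattern_on L w : {ffun L -> spin} := [ffun j => w (val j)].

Lemma pattern_on_eq L w w' :
  {in L, w =1 w'} -> pattern_on L w = pattern_on L w'.
Proof. by move=> ww'; apply/ffunP => j; rewrite !ffunE ww' ?fsvalP. Qed.

Lemma spliceE L (z : {ffun L -> spin}) w (j : L) : splice z w (val j) = z j.
Proof. by rewrite /splice valK. Qed.

Lemma splice_out L (z : {ffun L -> spin}) w i :
  i \notin L -> splice z w i = w i.
Proof. by move=> iL; rewrite /splice insubN. Qed.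

Lemma spliceK L (z : {ffun L -> spin}) w : pattern_on L (splice z w) = z.
Proof. by apply/ffunP => j; rewrite ffunE spliceE. Qed.

Lemma splice_splice L (z z' : {ffun L -> spin}) w :
  splice z (splice z' w) = splice z w.
Proof. by apply/funext => i; rewrite /splice; case: insubP. Qed.

Lemma splice_pattern_on L w : splice (pattern_on L w) w = w.
Proof.
apply/funext => i; rewrite /splice; case: insubP => // j _ <-.
by rewrite ffunE.
Qed.

Lemma splice_agree V L (z : {ffun L -> spin}) w w' :
  {in V, w =1 w'} -> {in V, splice z w =1 splice z w'}.
Proof. by move=> ww' i /ww'; rewrite /splice; case: insubP. Qed.

(** The sets that cannot distinguish configurations agreeing on [V] form a
    sigma-algebra containing the generators; this turns the abstract
    measurability of potentials into actual locality. *)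
Lemma sigma_spins_depends (V : set (site d)) (A : set (config d)) :
  sigma_spins V A -> forall w w', (forall i, V i -> w i = w' i) -> A w -> A w'.
Proof.
pose invariant (A : set (config d)) :=
  forall w w', (forall i, V i -> w i = w' i) -> A w -> A w'.
move: A; apply: (@smallest_sub _ (sigma_algebra setT) _ invariant) => [|A].
  split=> [w w' _ //|A Ainv|F Finv].
  - move=> w w' ww' [_ nAw]; split=> // /Ainv Aw'.
    by apply/nAw/Aw' => i /ww'.
  - by move=> w w' ww' [k _ Fkw]; exists k => //; exact: Finv ww' Fkw.
by move=> [i Vi [s ->]] w w' ww' /= <-; rewrite ww'.
Qed.

Lemma measurable_spin (i : site d) (s : spin) :
  measurable [set w : config d | w i = s].
Proof. by apply: sub_sigma_algebra; exists i => //; exists s. Qed.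

(** Such a set is the finite union, over the patterns on [V] that it allows,
    of the corresponding cylinders. *)
Lemma depends_on_measurable V (A : set (config d)) :
  depends_on V A -> measurable A.
Proof.
move=> AV.
rewrite (_ : A = \bigcup_(z in [set z : {ffun V -> spin} | A (splice z point)])
                 \bigcap_(j in [set: V]) [set w | w (val j) = z j]).
  apply: fin_bigcup_measurable => [|z _]; first exact: finite_finset.
  apply: fin_bigcap_measurable => [|j _]; first exact: finite_finset.
  exact: measurable_spin.
have cyl w (z : {ffun V -> spin}) :
    (forall j : V, w (val j) = z j) -> A (splice z point) = A w.
  move=> wz; apply: AV => i iV.
  by rewrite [LHS](spliceE z point [` iV]%fset) -wz.
apply/seteqP; split=> [w Aw|w [z /= Az wz]]; last first.
  by rewrite -(cyl w z)// => j; exact: wz.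
exists (pattern_on V w) => [/=|j _ /=]; last by rewrite ffunE.
by rewrite (cyl w)// => j; rewrite ffunE.
Qed.

Lemma depends_on_measurable_fun d' (T : measurableType d') V
    (f : config d -> T) :
  depends_on V f -> measurable_fun setT f.
Proof.
move=> fV _ B _; rewrite setTI; apply: (@depends_on_measurable V) => w w' ww'.
by rewrite /preimage /= (fV _ _ ww').
Qed.

Lemma local_coordinates_measurable (h : config d -> config d) :
  (forall i, exists V, depends_on V (h^~ i)) -> measurable_fun setT h.
Proof.
move=> hloc.
apply: (@measurability _ _ _ _ _ _ (spin_events [set: site d])) => //.
move=> _ [_ [i _ [s ->]] <-]; rewrite setTI; have [V hV] := hloc i.
apply: (@depends_on_measurable V) => w w' ww'.
by rewrite /preimage /= (hV _ _ ww').
Qed.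

Lemma measurable_splice L (z : {ffun L -> spin}) :
  measurable_fun setT (splice z).
Proof.
apply: local_coordinates_measurable => i; exists [fset i]%fset => w w' ww'.
exact: splice_agree ww' i (fset11 i).
Qed.

Lemma exists_box (i : site d) : exists N, i \in box d N.
Proof.
exists (\max_(k < d) `|i ord0 k|)%N; rewrite in_box; apply/forallP => k.
rewrite -ler_norml -abszE lez_nat.
exact: (@leq_bigmax _ (fun k : 'I_d => `|i ord0 k|%N)).
Qed.

Lemma subset_box N M : (N <= M)%N -> (box d N `<=` box d M)%fset.
Proof.
move=> NM; apply/fsubsetP => i; rewrite !in_box => /forallP iN.
apply/forallP => k; have := iN k; rewrite -!ler_norml => /le_trans; apply.
by rewrite lez_nat.
Qed.

Lemma nbhs_cylinder V w : nbhs w [set w' | {in V, w =1 w'}].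
Proof.
apply: (@filterS _ (nbhs w) _
    (\bigcap_(i in [set` V]) [set w' : config d | w' i = w i])).
  by move=> w' ww' i iV; rewrite -ww'.
apply: filter_bigI => i _.
have /(_ [set w i] (discrete_set1 (w i))) :=
  @proj_continuous (site d) (fun=> spin) i w.
exact.
Qed.

Lemma depends_on_continuous (T : topologicalType) V (f : config d -> T) :
  depends_on V f -> continuous f.
Proof.
move=> fV w A /nbhs_singleton Afw; apply: filterS (nbhs_cylinder V w).
by move=> w' /fV /= <-.
Qed.

(** The box cylinders around [w] generate a filter along which every spin
    converges to that of [w], hence which is finer than the neighborhoods of
    [w] in the product topology. *)
Lemma nbhs_box_cylinder w (U : set (config d)) :
  nbhs w U -> exists N, forall w', {in box d N, w =1 w'} -> U w'.
Proof.
pose F : set_system (config d) :=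
  [set U | exists N, forall w', {in box d N, w =1 w'} -> U w'].
have FF : Filter F.
  split; first by exists 0%N.
  - move=> P Q [N sP] [M sQ]; exists (maxn N M) => w' ww'.
    split; [apply: sP|apply: sQ] => i iN; apply: ww'.
    + by apply: fsubsetP iN; apply: subset_box; exact: leq_maxl.
    + by apply: fsubsetP iN; apply: subset_box; exact: leq_maxr.
  - by move=> P Q PQ [N sP]; exists N => w' /sP /PQ.
suff : F --> w by apply.
apply/cvg_sup => i A [B [[C oC <-] Cwi] CA].
have [N iN] := exists_box i; exists N => w' ww'; apply: CA.
by rewrite /preimage /= /proj -(ww' _ iN).
Qed.

(** An open set is the countable union, over [N], of the sets of points whose
    cylinder over the box [N] it contains.  The measurable structure of
    [config d] thus contains the Borel sets. *)
Lemma open_config_measurable (U : set (config d)) : open U -> measurable U.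
Proof.
move=> oU.
rewrite (_ : U = \bigcup_N [set w : config d |
    forall w' : config d, {in box d N, w =1 w'} -> U w']).
  apply: bigcupT_measurable => N; apply: (@depends_on_measurable (box d N)).
  move=> w1 w2 w12; rewrite propeqE; split=> sU w' ww'; apply: sU => i iN.
    by rewrite w12 // ww'.
  by rewrite -w12 // ww'.
apply/seteqP; split=> [w Uw|w [N _ /(_ w)]]; last by apply.
have /nbhs_box_cylinder[N sU] : nbhs w U by exact: open_nbhs_nbhs.
by exists N.
Qed.

End local_functions.

(** * Hamiltonians and Boltzmann weights *)

Section hamiltonians.
Context (R : realType) (d : nat) (Phi : interaction R d).
Implicit Types (w : config d) (L X : {fset site d}).

Lemma potential_depends X : depends_on X (Phi X).
Proof.
move=> w w' ww'.
have := @potential_meas _ _ Phi X [set Phi X w] (measurable_set1 _).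
by move=> /sigma_spins_depends /(_ w w')/(_ ww' erefl)/esym.
Qed.

(** The box [M] is large enough for all interactions with the box [N] to take
    place inside it. *)
Definition screens N M := (N <= M)%N /\
  forall X, (X `&` box d N != fset0)%fset -> ~~ (X `<=` box d M)%fset ->
    forall w, Phi X w = 0.

Lemma screensW N M n : screens N M -> (M <= n)%N -> screens N n.
Proof.
move=> [NM Phi0] Mn; split; first exact: leq_trans NM Mn.
move=> X XN Xn; apply: Phi0 => //; apply: contraNN Xn => XM.
exact: fsubset_trans XM (subset_box d Mn).
Qed.

(** A set with a point in the box [N] and another outside the box [N + m] has
    two points whose coordinates differ by more than [m]. *)
Lemma finite_range_screens N : finite_range Phi -> exists M, screens N M.
Proof.
move=> [r r0 Phi0]; exists (N + Num.bound r)%N; split; first exact: leq_addr.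
move=> X /fset0Pn[x]; rewrite inE => /andP[xX xN].
move=> /fsubsetPn[y yX]; rewrite in_box => /forallPn[k yk]; apply: Phi0.
apply: (lt_le_trans (archi_boundP (ltW r0))); rewrite ler_nat /diam.
apply: leq_trans (leq_bigmax_seq _ xX _) => //.
apply: leq_trans (leq_bigmax_seq _ yX _) => //.
apply: leq_trans (leq_bigmax k) => //=.
move: xN; rewrite in_box => /forallP/(_ k).
move: yk; rewrite -!ler_norml -ltNge.
lia.
Qed.

(** Screening reduces the sum over an infinite set of [X] that defines the
    Hamiltonian to an honest finite sum. *)
Lemma hamiltonian_box N M (z : {ffun box d N -> spin}) w : screens N M ->
  hamiltonian Phi z w =
  \sum_(X <- fpowerset (box d M) | (X `&` box d N != fset0)%fset)
    Phi X (splice z w).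
Proof.
move=> [NM Phi0]; rewrite /hamiltonian.
rewrite (fsbigE [seq X <- fpowerset (box d M) | (X `&` box d N != fset0)%fset]).
- rewrite big_filter_cond; apply: eq_bigl => X.
  have [XN|//] := boolP (X `&` box d N != fset0)%fset.
  by apply/mem_set.
- exact/filter_uniq/fset_uniq.
- by move=> X /=; rewrite mem_filter => /andP[].
- by move=> X /= XN; rewrite mem_filter XN fpowersetE => /Phi0; exact.
Qed.

Lemma hamiltonian_depends N M (z : {ffun box d N -> spin}) : screens N M ->
  depends_on (box d M) (hamiltonian Phi z).
Proof.
move=> NM w w' ww'; rewrite !(hamiltonian_box _ _ NM).
rewrite [LHS]big_seq_cond [RHS]big_seq_cond; apply: eq_bigr => X.
rewrite fpowersetE => /andP[/fsubsetP XM _]; apply: potential_depends.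
by apply: splice_agree => i /XM /ww'.
Qed.

(** The probability that the Gibbs kernel on [L] with boundary condition [w]
    gives to the pattern [z]. *)
Definition boltzmann_weight L (z : {ffun L -> spin}) w : R :=
  (partition_function Phi L w)^-1 *
  ((\prod_i mu0 R (z i)) * expR (- hamiltonian Phi z w)).

Lemma gibbs_kernelE L (A : set (config d)) w :
  gibbs_kernel Phi L A w =
  \sum_(z : {ffun L -> spin}) boltzmann_weight z w * \1_A (splice z w).
Proof.
rewrite /gibbs_kernel /spin_integral mulr_sumr; apply: eq_bigr => z _.
by rewrite /boltzmann_weight !mulrA.
Qed.

Lemma boltzmann_weight_ge0 L (z : {ffun L -> spin}) w :
  0 <= boltzmann_weight z w.
Proof.
have prior_ge0 (y : {ffun L -> spin}) : 0 <= \prod_i mu0 R (y i).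
  by apply: prodr_ge0 => i _; rewrite /mu0 invr_ge0.
apply: mulr_ge0; last by rewrite mulr_ge0 ?expR_ge0.
by rewrite invr_ge0; apply: sumr_ge0 => y _; rewrite mulr_ge0 ?expR_ge0.
Qed.

Lemma measurable_boltzmann_weight N (z : {ffun box d N -> spin}) :
  finite_range Phi -> measurable_fun setT (boltzmann_weight z).
Proof.
move=> /(finite_range_screens N)[M NM].
apply: (@depends_on_measurable_fun _ _ _ (box d M)) => w w' ww'.
rewrite /boltzmann_weight (hamiltonian_depends _ NM ww'); congr (_^-1 * _).
rewrite /partition_function /spin_integral; apply: eq_bigr => y _.
by rewrite (hamiltonian_depends _ NM ww').
Qed.

End hamiltonians.

(** * Integration against a mixture *)

Section mixture.
Local Open Scope ereal_scope.
Context (R : realType) (dT : measure_display) (T : measurableType dT).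
Variables (mu : {measure set T -> \bar R}) (I : finType).
Variables (p : I -> T -> R) (s : I -> T -> T).
Hypotheses (p_ge0 : forall i x, (0 <= p i x)%R).
Hypotheses (mp : forall i, measurable_fun setT (p i)).
Hypotheses (ms : forall i, measurable_fun setT (s i)).
Hypothesis mu_mixture : forall A, measurable A ->
  mu A = \int[mu]_x (\sum_i p i x * \1_A (s i x))%:E.

Let mixture (f : T -> \bar R) x : \bar R := \sum_i (p i x)%:E * f (s i x).

Import HBNNSimple.

Let measurable_mixture (f : T -> \bar R) :
  measurable_fun setT f -> measurable_fun setT (mixture f).
Proof.
move=> mf; apply: emeasurable_sum => i; apply: emeasurable_funM.
  exact/measurable_EFinP.
exact: measurableT_comp.
Qed.

Let mixture_ge0 (f : T -> \bar R) :
  (forall x, 0 <= f x) -> forall x, 0 <= mixture f x.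
Proof. by move=> f0 x; apply: sume_ge0 => i _; rewrite mule_ge0 ?lee_fin. Qed.

Let integral_mixture_nnsfun (h : {nnsfun T >-> R}) :
  \int[mu]_x (h x)%:E = \int[mu]_x mixture (EFin \o h) x.
Proof.
pose A r := h @^-1` [set r].
pose M r x : R := (\sum_i p i x * \1_(A r) (s i x))%R.
(* For [r < 0] the level set of the nonnegative function [h] is empty. *)
have M_ge0 r x : 0 <= (r * M r x)%:E.
  rewrite lee_fin; have [r0|r0] := leP 0%R r.
    by rewrite mulr_ge0//; apply: sumr_ge0 => i _; rewrite mulr_ge0.
  rewrite /M /A preimage_nnfun0// big1 ?mulr0// => i _.
  by rewrite indic0 mulr0.
have mM r : measurable_fun setT (M r).
  apply: measurable_sum => i; apply: measurable_funM => //.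
  apply: (measurableT_comp _ (ms i)); apply: measurable_indic.
  exact: measurable_funPTI.
have mixtureE x :
    mixture (EFin \o h) x = \sum_(r <- fset_set (range h)) (r * M r x)%:E.
  rewrite /mixture [LHS]sumEFin [RHS]sumEFin; congr EFin => /=.
  under eq_bigr do rewrite fimfunE fsbig_finite//= mulr_sumr.
  rewrite exchange_big; apply: eq_bigr => r _.
  by rewrite mulr_sumr; apply: eq_bigr => i _; rewrite mulrCA.
under [RHS]eq_integral do rewrite mixtureE.
rewrite ge0_integral_sum//; last first.
  by move=> r; apply/measurable_EFinP; exact: measurable_funM.
rewrite integralT_nnsfun sintegralE fsbig_finite//=; apply: eq_bigr => r _.
have [r0|r0] := leP 0%R r; last first.
  rewrite preimage_nnfun0// measure0 mule0 integral0_eq// => x _.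
  rewrite /M /A preimage_nnfun0// big1 ?mulr0// => i _.
  by rewrite indic0 mulr0.
under eq_integral do rewrite EFinM.
rewrite ge0_integralZl_EFin//; last 2 first.
- move=> x _; rewrite lee_fin.
  by apply: sumr_ge0 => i _; rewrite mulr_ge0.
- exact/measurable_EFinP.
by rewrite mu_mixture.
Qed.

(** Both sides are additive and continuous along increasing sequences, so the
    assumption on indicators passes to simple functions and to their limits. *)
Lemma ge0_integral_mixture (f : T -> \bar R) : (forall x, 0 <= f x) ->
  measurable_fun setT f -> \int[mu]_x f x = \int[mu]_x mixture f x.
Proof.
move=> f0 mf; pose f_ := nnsfun_approx measurableT mf.
have f_cvg x : EFin \o f_^~ x @ \oo --> f x by exact: cvg_nnsfun_approx.
have f_nd m n x : (m <= n)%N -> (f_ m x <= f_ n x)%R.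
  by move=> mn; exact/lefP/nd_nnsfun_approx.
transitivity (\int[mu]_x limn (fun n => (f_ n x)%:E)).
  by apply: eq_integral => x _; apply/esym/cvg_lim => //; exact: f_cvg.
rewrite monotone_convergence//; last 3 first.
  by move=> n; exact/measurable_EFinP.
  by move=> n x _; rewrite lee_fin.
  by move=> x _ m n mn; rewrite lee_fin; exact: f_nd.
transitivity (limn (fun n => \int[mu]_x mixture (EFin \o f_ n) x)).
  by apply: congr_lim; apply/funext => n; exact: integral_mixture_nnsfun.
rewrite -monotone_convergence//; last 3 first.
  by move=> n; apply: measurable_mixture; exact/measurable_EFinP.
  by move=> n x _; apply: mixture_ge0 => y; rewrite lee_fin.
  move=> x _ m n mn; apply: lee_sum => i _.
  by rewrite lee_wpmul2l ?lee_fin// f_nd.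
apply: eq_integral => x _; apply/cvg_lim => //.
apply: cvg_nnesum => i _; first by apply: nearW => n; rewrite mule_ge0 ?lee_fin.
by apply: cvgeZl => //; exact: f_cvg.
Qed.

End mixture.

(** * Local transformations permute the patterns on a box *)

Section block.
Context (d : nat) (L : {fset site d}).
Implicit Types (w : config d) (tau : config d -> config d).
Implicit Types (sigma : {perm {ffun L -> spin}}).

Definition block_permutation sigma tau := forall z w,
  tau (splice z w) = splice (sigma z) w.

Lemma block_permutationE sigma tau w : block_permutation sigma tau ->
  tau w = splice (sigma (pattern_on L w)) w.
Proof. by move=> tauP; rewrite -tauP splice_pattern_on. Qed.

Lemma block_permutation_cancel sigma tau tau' :
  block_permutation sigma tau -> block_permutation sigma^-1 tau' ->
  cancel tau tau'.
Proof.
move=> tauP tau'P w.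
by rewrite (block_permutationE w tauP) tau'P permK splice_pattern_on.
Qed.

Lemma block_permutation_bij sigma tau :
  block_permutation sigma tau -> bijective tau.
Proof.
move=> tauP; pose tau' w := splice (sigma^-1 (pattern_on L w))%g w.
have tau'P : block_permutation sigma^-1 tau'.
  by move=> z w; rewrite /tau' spliceK splice_splice.
exists tau'; first exact: block_permutation_cancel tauP tau'P.
by apply: block_permutation_cancel tau'P _; rewrite invgK.
Qed.

Lemma block_permutationV sigma tau tau' :
  block_permutation sigma tau -> cancel tau tau' ->
  block_permutation sigma^-1 tau'.
Proof.
by move=> tauP tauK z w; rewrite -{1}[z](permKV sigma) -tauP tauK.
Qed.

(** The permutation is read off with an arbitrary configuration outside [L]:
    by locality, it does not depend on the choice. *)
Lemma local_injection_block_permutation tau : injective tau ->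
  (forall w i, i \notin L -> tau w i = w i) ->
  depends_on L (fun w => pattern_on L (tau w)) ->
  exists sigma, block_permutation sigma tau.
Proof.
move=> tau_inj tau_out tau_in.
pose f (z : {ffun L -> spin}) := pattern_on L (tau (splice z point)).
have fE z w : tau (splice z w) = splice (f z) w.
  have -> : f z = pattern_on L (tau (splice z w)).
    apply: tau_in => i iL.
    by rewrite -[ i ]/(val (FSetSub iL)) !spliceE.
  apply/funext => i; have [iL|iL] := boolP (i \in L).
    by rewrite -[ i ]/(val (FSetSub iL)) spliceE ffunE.
  by rewrite tau_out// !splice_out.
have f_inj : injective f.
  move=> z z' zz'; rewrite -(spliceK z point) -(spliceK z' point).
  by congr pattern_on; apply: tau_inj; rewrite !fE zz'.
by exists (perm f_inj) => z w; rewrite permE fE.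
Qed.

Lemma generated_block_permutation (S : set (config d -> config d)) :
  (forall tau, S tau -> exists sigma, block_permutation sigma tau) ->
  forall tau, Defs.generated_group S tau ->
    exists sigma, block_permutation sigma tau.
Proof.
move=> Sblock tau; elim=> {tau} [tau /Sblock//||tau tau' _ [s sP] _ [s' s'P]|].
- by exists 1%g => z w; rewrite perm1.
- by exists (s' * s)%g => z w; rewrite /= permM s'P sP.
- move=> tau tau' _ [s sP] tauK _; exists s^-1%g.
  exact: block_permutationV sP tauK.
Qed.

Lemma spin_flip_block_permutation i : i \in L ->
  exists sigma, block_permutation sigma (spin_flip i).
Proof.
move=> iL; apply: local_injection_block_permutation.
- apply: (@can_inj _ _ _ (spin_flip i)) => w; apply/funext => k.
  by rewrite /spin_flip; case: eqP => // _; rewrite negbK.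
- by move=> w k kL; rewrite /spin_flip; case: eqP kL => // ->; rewrite iL.
- move=> w w' ww'; apply: pattern_on_eq => k kL.
  by rewrite /spin_flip ww'.
Qed.

Lemma spin_exchange_block_permutation i j : i \in L -> j \in L ->
  exists sigma, block_permutation sigma (spin_exchange i j).
Proof.
move=> iL jL; apply: local_injection_block_permutation.
- apply: (@can_inj _ _ _ (spin_exchange i j)) => w; apply/funext => k.
  rewrite /spin_exchange !eqxx; case: (eqVneq k i) => [->|ki].
    by case: (eqVneq j i) => [->|].
  by case: (eqVneq k j) => [->|].
- move=> w k kL; rewrite /spin_exchange.
  by case: eqP kL => [->|_]; rewrite ?iL//; case: eqP => // ->; rewrite jL.
- move=> w w' ww'; apply: pattern_on_eq => k kL.
  by rewrite /spin_exchange !ww'.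
Qed.

Lemma measurable_block_permutation sigma tau :
  block_permutation sigma tau -> measurable_fun setT tau.
Proof.
move=> tauP; apply: local_coordinates_measurable => i.
exists (i |` L)%fset => w w' ww'; rewrite !(block_permutationE _ tauP).
rewrite (@pattern_on_eq _ L w w') => [|k kL]; last by rewrite ww'// inE kL orbT.
exact: (splice_agree _ ww' (fset1U1 i L)).
Qed.

Lemma config_inv_block_permutation sigma tau :
  block_permutation sigma tau ->
  block_permutation sigma^-1 (config_inv tau).
Proof.
move=> tauP.
by have [tauK _] := config_invK (block_permutation_bij tauP);
  exact: block_permutationV tauP tauK.
Qed.

End block.

Lemma local_group_block_permutation d (G : set (config d -> config d)) tau :
  G = @exchange_group d \/ G = @flip_group d -> G tau ->
  exists N, exists sigma : {perm {ffun box d N -> spin}},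
    block_permutation sigma tau.
Proof.
move=> [] -> [N _ tauG]; exists N.
- apply: generated_block_permutation tauG => _ [i [j [iN jN _ ->]]].
  exact: spin_exchange_block_permutation.
- apply: generated_block_permutation tauG => _ [i iN ->].
  exact: spin_flip_block_permutation.
Qed.

(** * Energy differences *)

Section energy.
Context (R : realType) (d : nat) (Phi : interaction R d) (N : nat).
Context (sigma : {perm {ffun box d N -> spin}}) (tau : config d -> config d).
Hypothesis Phi_range : finite_range Phi.
Hypothesis tauP : block_permutation sigma tau.
Implicit Types (w : config d).

(** The value at which the energy increments stabilize: the spins of [w] outside
    the box act as boundary condition for both patterns, that of [w] and that
    of its image under the inverse of [tau]. *)
Definition local_energy_difference w : R :=
  hamiltonian Phi (pattern_on (box d N) w) w -
  hamiltonian Phi (sigma^-1 (pattern_on (box d N) w))%g w.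

(** The sets [X] disjoint from the box [N] contribute zero, as [tau] does not
    move the spins in them. *)
Lemma energy_incrementE n w : screens Phi N n ->
  energy_increment Phi tau w n = local_energy_difference w.
Proof.
move=> Nn; rewrite /local_energy_difference !(hamiltonian_box _ _ Nn).
have invE := block_permutationE w (config_inv_block_permutation tauP).
rewrite -sumrB [RHS]big_mkcond; apply: eq_bigr => X _.
rewrite splice_pattern_on -invE; case: ifPn => // /negPn/eqP XN.
apply/eqP; rewrite subr_eq0; apply/eqP/potential_depends => i iX.
rewrite invE splice_out//; apply/negP => iN.
by have := in_fset0 i; rewrite -XN inE iX iN.
Qed.

Lemma energy_increment_cvg w :
  energy_increment Phi tau w @ \oo --> local_energy_difference w.
Proof.
have [M NM] := finite_range_screens N Phi_range.
apply: cvg_near_cst; exists M => // n /= Mn.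
by rewrite energy_incrementE//; exact: screensW NM Mn.
Qed.

Lemma energy_differenceE w :
  energy_difference Phi tau w = local_energy_difference w.
Proof. by apply/cvg_lim => //; exact: energy_increment_cvg. Qed.

Lemma energy_difference_depends :
  exists M, depends_on (box d M) (energy_difference Phi tau).
Proof.
have [M NM] := finite_range_screens N Phi_range.
exists M => w w' ww'; rewrite !energy_differenceE /local_energy_difference.
rewrite (@pattern_on_eq _ (box d N) w w'); last first.
  by move=> i iN; apply: ww'; apply: (fsubsetP (subset_box d NM.1)).
by rewrite !(hamiltonian_depends _ NM ww').
Qed.

(** The energy difference replaces exp (- H(z | w)) by exp (- H(sigma^-1 z | w))
    and this is the only change in the weight: the normalization depends on the
    boundary condition alone, and all patterns have the same a priori weight. *)
Lemma boltzmann_weight_energy z w :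
  boltzmann_weight Phi z w * expR (energy_difference Phi tau (splice z w)) =
  boltzmann_weight Phi (sigma^-1 z)%g w.
Proof.
rewrite energy_differenceE /local_energy_difference spliceK.
have hamE (y : {ffun box d N -> spin}) :
    hamiltonian Phi y (splice z w) = hamiltonian Phi y w.
  by rewrite /hamiltonian splice_splice.
rewrite !hamE /boltzmann_weight -!mulrA -expRD addrA addNr add0r.
(* [mu0] is constant, so the two products over the sites are convertible. *)
by [].
Qed.

End energy.

(** * Quasi-invariance of Gibbs measures *)

Section quasi_invariance.
Context (R : realType) (d : nat) (Phi : interaction R d).
Context (mu : probability (config d) R) (N : nat).
Hypotheses (Phi_range : finite_range Phi) (mu_gibbs : gibbs_measure Phi mu).
Local Open Scope ereal_scope.

(** For the indicator of a set, this is the Gibbs property integrated over the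
    whole space, the conditional expectation having the same integral as the
    indicator; the mixture lemma extends it to functions. *)
Lemma dlr_integral (f : config d -> \bar R) :
  (forall w, 0 <= f w) -> measurable_fun setT f ->
  \int[mu]_w f w = \int[mu]_w
    \sum_(z : {ffun box d N -> spin})
      (boltzmann_weight Phi z w)%:E * f (splice z w).
Proof.
move=> f0 mf; apply: ge0_integral_mixture => // [z w|z|z|A mA].
- exact: boltzmann_weight_ge0.
- exact: measurable_boltzmann_weight.
- exact: measurable_splice.
have [g [mg ig gA] g_gibbs] := mu_gibbs mA (box d N).
transitivity (\int[mu]_w (\1_A w)%:E).
  by rewrite integral_indic// setIT.
have sT : sigma_spins (~` [set` box d N]) setT.
  have [s0 sD _] :=
    smallest_sigma_algebra setT (spin_events (~` [set` box d N])).
  by rewrite -[X in sigma_spins _ X]setD0; exact: sD.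
rewrite -gA//.
apply: ae_eq_integral => //.
- exact: measurable_int ig.
- apply/measurable_EFinP/measurable_sum => z; apply: measurable_funM.
    exact: measurable_boltzmann_weight.
  apply: (measurableT_comp _ (measurable_splice z)).
  exact: measurable_indic.
apply: filterS g_gibbs => w gw _.
by rewrite /= gw gibbs_kernelE.
Qed.

Variables (sigma : {perm {ffun box d N -> spin}}) (tau : config d -> config d).
Hypothesis tauP : block_permutation sigma tau.

Lemma measurable_energy_density :
  measurable_fun setT (fun w => expR (energy_difference Phi tau w)).
Proof.
have [M EM] := energy_difference_depends Phi_range tauP.
apply: (@depends_on_measurable_fun _ _ _ (box d M)) => w w' ww'.
by rewrite (EM _ _ ww').
Qed.

Lemma ge0_integral_block_permutation (f : config d -> \bar R) :
  (forall w, 0 <= f w) -> measurable_fun setT f ->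
  \int[mu]_w f (tau w) =
    \int[mu]_w ((expR (energy_difference Phi tau w))%:E * f w).
Proof.
move=> f0 mf.
have mtau := measurable_block_permutation tauP.
rewrite [LHS]dlr_integral//; last exact: measurableT_comp mf mtau.
rewrite [RHS]dlr_integral//; last 2 first.
  by move=> w; rewrite mule_ge0// lee_fin expR_ge0.
  apply: emeasurable_funM => //; apply/measurable_EFinP.
  exact: measurable_energy_density.
apply: eq_integral => w _.
rewrite [RHS](reindex_inj (@perm_inj _ sigma)); apply: eq_bigr => z _ /=.
by rewrite muleA -EFinM (boltzmann_weight_energy Phi_range tauP) permK tauP.
Qed.

(** The weight is positive, so it factors out of the positive and of the
    negative part of [f], and each part obeys the nonnegative case. *)
Lemma integral_block_permutation (f : config d -> R) :
  measurable_fun setT f ->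
  \int[mu]_w (f (tau w))%:E =
    \int[mu]_w (expR (energy_difference Phi tau w) * f w)%:E.
Proof.
move=> /measurable_EFinP mf; pose x w := expR (energy_difference Phi tau w).
rewrite integralE [RHS]integralE; congr (_ - _).
  have := ge0_integral_block_permutation
    (funepos_ge0 _) (measurable_funepos mf).
  have <- : (fun w => (x w)%:E * (EFin \o f)^\+ w) =
            (fun w => (x w * f w)%:E)^\+.
    apply/funext => w; rewrite !funeposE maxe_pMr ?mule0//.
    exact: expR_ge0.
  by move=> <-; apply: eq_integral => w _; rewrite !funeposE.
have := ge0_integral_block_permutation
  (funeneg_ge0 _) (measurable_funeneg mf).
have <- : (fun w => (x w)%:E * (EFin \o f)^\- w) =
          (fun w => (x w * f w)%:E)^\-.
  apply/funext => w; rewrite !funenegE maxe_pMr ?mule0 ?muleN//.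
  exact: expR_ge0.
by move=> <-; apply: eq_integral => w _; rewrite !funenegE.
Qed.

End quasi_invariance.

(** * Complex observables *)

(** Superlevel sets of [g \o f] are open because [g] does not increase
    distances, and open sets are measurable. *)
Lemma in_C_measurable (R : realType) (d : nat) (f : config d -> R[i])
    (g : R[i] -> R) :
  (forall z z', (`|g z - g z'|%:C <= `|z - z'|)%C) -> in_C f ->
  measurable_fun setT (g \o f).
Proof.
move=> g_lip f_cont; apply: (measurability _ (RGenOInfty.measurableE R)).
move=> _ [_ [a ->] <-]; rewrite setTI; apply: open_config_measurable.
rewrite openE => w; rewrite /preimage /= in_itv/= andbT => aw.
have e_gt0 : 0 < ((g (f w) - a)%:C)%C :> R[i] by rewrite ltcR subr_gt0.
have /cvgrPdist_lt/(_ _ e_gt0) := f_cont w.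
apply: filterS => w' ww'; rewrite /= in_itv/= andbT.
have := le_lt_trans (g_lip _ _) ww'; rewrite ltcR => /ltr_normlW.
by rewrite ltrD2l ltrN2.
Qed.

Lemma in_C_measurable_Re (R : realType) (d : nat) (f : config d -> R[i]) :
  in_C f -> measurable_fun setT (@complex.Re R \o f).
Proof.
apply: in_C_measurable => z z'.
by rewrite -raddfB; exact: normc_ge_Re.
Qed.

Lemma in_C_measurable_Im (R : realType) (d : nat) (f : config d -> R[i]) :
  in_C f -> measurable_fun setT (@complex.Im R \o f).
Proof.
apply: in_C_measurable => z z'.
rewrite -raddfB; case: (z - z') => a b.
by rewrite normc_def /= lecR -sqrtr_sqr ler_wsqrtr// lerDr sqr_ge0.
Qed.

Theorem theorem6p5 (R : realType) (d : nat) (Phi : interaction R d)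
    (mu : probability (config d) R) (G : set (config d -> config d))
    (Phi_inv : translation_invariant Phi) (Phi_range : finite_range Phi)
    (Phi_sum : absolutely_summable Phi) (mu_gibbs : gibbs_measure Phi mu)
    (G_local : G = @exchange_group d \/ G = @flip_group d) :
  (forall tau, G tau -> forall w, cvgn (energy_increment Phi tau w)) /\
  strongly_quasi_invariant_with (state_of mu) G (gibbs_cocycle Phi).
Proof.
split=> tau /(local_group_block_permutation G_local)[N [sigma tauP]].
  move=> w; apply/cvg_ex; eexists.
  exact: energy_increment_cvg Phi_range tauP w.
split.
- have [M EM] := energy_difference_depends Phi_range tauP.
  apply: (@depends_on_continuous _ _ (box d M)) => w w' ww'.
  by rewrite /gibbs_cocycle (EM _ _ ww').
- by move=> w; exact: conjc_real.
move=> f f_cont; rewrite /state_of.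
have mR := in_C_measurable_Re f_cont.
have mI := in_C_measurable_Im f_cont.
rewrite /Rintegral.
congr (fine _ +i* fine _)%C.
  rewrite (integral_block_permutation Phi_range mu_gibbs tauP mR).
  apply: eq_integral => w _; congr EFin.
  by rewrite /= /gibbs_cocycle; case: (f w) => a b /=; rewrite mul0r subr0.
rewrite (integral_block_permutation Phi_range mu_gibbs tauP mI).
apply: eq_integral => w _; congr EFin.
by rewrite /= /gibbs_cocycle; case: (f w) => a b /=; rewrite mul0r addr0.
Qed.
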